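(* Let $G$ be a branch group (acting on a spherically homogeneous rooted tree). If $\mathrm{L}(G)\ne 1$ then $G$ is periodic and there exists a prime $p$ such that: (i) $\mathrm{L}(G)$ consists of $p$-elements. (ii) $G$ is virtually a $p$-group.
   Context: Engel elements. For $g,x$ in a group $G$ put $[g,_0 x]=g$ and $[g,_n x]=[[g,_{n-1}x],x]$ for $n\ge 1$. An element $x\in G$ is a left Engel element of $G$ if for every $g\in G$ there is $n=n(g,x)\in\mathbb{N}$ with $[g,_n x]=1$. The set of left Engel elements is denoted $\mathrm{L}(G)$. Trees. Let $(d_n)_{n\ge 1}$ be a sequence of integers greater than $1$. The corresponding spherically homogeneous rooted tree $\mathcal{T}$ is the rooted tree in which every vertex at level $n$ (distance $n$ from the root) has exactly $d_{n+1}$ immediate descendants. $\mathcal{L}_n$ is the set of vertices at level $n$, $\mathcal{T}_v$ is the subtree hanging from the vertex $v$, and $\mathrm{Aut}\,\mathcal{T}$ is the group of automorphisms of $\mathcal{T}$ (bijections of the vertex set preserving the root and incidence). For $G\le \mathrm{Aut}\,\mathcal{T}$ and a vertex $v$, the rigid stabilizer of $v$ is $\mathrm{rst}_G(v)=\{g\in G\mid g(u)=u \text{ for all vertices } u \text{ outside } \mathcal{T}_v\}$, and $\mathrm{rst}_G(n)=\langle \mathrm{rst}_G(v)\mid v\in\mathcal{L}_n\rangle=\prod_{v\in\mathcal{L}_n}\mathrm{rst}_G(v)$. The group $G$ is spherically transitive if it acts transitively on every $\mathcal{L}_n$. A branch group is a spherically transitive subgroup $G\le\mathrm{Aut}\,\mathcal{T}$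 with $|G:\mathrm{rst}_G(n)|<\infty$ for all $n\in\mathbb{N}$. A group is periodic if all its elements have finite order. An element is a $p$-element if its order is a power of the prime $p$; a (possibly infinite) group is a $p$-group if all its elements are $p$-elements, and is virtually a $p$-group if it has a subgroup of finite index that is a $p$-group. *)

(* Defs.v *)
From HB Require Import structures.
From mathcomp Require Import all_boot.
From mathcomp Require Import all_classical.

Set Implicit Arguments.
Unset Strict Implicit.
Unset Printing Implicit Defensive.

Local Open Scope classical_set_scope.
Local Open Scope group_scope.

Section Groups.
Variable gT : groupType.
Implicit Types (G H : set gT) (g x : gT).

Definition subgroup G : Prop :=
  [/\ G 1, forall x y, G x -> G y -> G (x * y) & forall x, G x -> G x^-1].

Definition generated (A : set gT) : set gT := smallest subgroup A.

Definition has_finite_index G H : Prop :=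
  finite_set [set [set x * h | h in H] | x in G].

(* An element of infinite order is related to no [n]. *)
Definition has_order x (n : nat) : Prop :=
  [/\ (0 < n)%N, x ^+ n = 1
    & forall m, (0 < m)%N -> x ^+ m = 1 -> (n <= m)%N].

Definition periodic G : Prop := forall x, G x -> exists n, has_order x n.

Definition p_element (p : nat) x : Prop := exists k, has_order x (p ^ k)%N.

Definition p_group (p : nat) G : Prop := forall x, G x -> p_element p x.

Definition virtually_p_group (p : nat) G : Prop :=
  exists H, [/\ subgroup H, H `<=` G, has_finite_index G H & p_group p H].

(* [~ g, x] = g^-1 * x^-1 * g * x *)
Definition iter_commg g (n : nat) x : gT := iter n (fun h => [~ h, x]) g.

Definition left_engel G : set gT :=
  [set x | G x /\ forall g, G g -> exists n, iter_commg g n x = 1].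

End Groups.

Section Tree.
(* [d n] is the number of children of the vertices at level [n], so the
   sequence usually written (d_n) for n >= 1 is shifted by one. *)
Variable d : nat -> nat.

Definition is_vertex (s : seq nat) : bool :=
  all (fun i => nth 0 s i < d i)%N (iota 0 (size s)).

(* A vertex is the word of the child indices met on the path from the root;
   its level, the distance to the root, is the length of that word. *)
Definition vertex := {s : seq nat | is_vertex s}.

Implicit Types u v : vertex.

Definition root : vertex := exist _ [::] isT.

Definition level (n : nat) : set vertex := [set v | size (val v) = n].

Definition is_child u v : Prop := exists i, val v = rcons (val u) i.

Definition adjacent u v : Prop := is_child u v \/ is_child v u.

Definition subtree v : set vertex := [set u | prefix (val v) (val u)].

Record aut := Aut {
  aut_fun :> vertex -> vertex;
  aut_bij : bijective aut_fun;
  aut_root : aut_fun root = root;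
  aut_adj : forall u v, adjacent (aut_fun u) (aut_fun v) <-> adjacent u v }.

HB.instance Definition _ := gen_eqMixin aut.
HB.instance Definition _ := gen_choiceMixin aut.

Lemma aut_eq (f g : aut) : f =1 g -> f = g.
Proof.
case: f g => f fb fr fa [g gb gr ga] /= /funext fg; subst g.
by congr Aut; exact: Prop_irrelevance.
Qed.

Definition aut1 : aut :=
  @Aut id (Bijective (fun=> erefl) (fun=> erefl)) erefl
    (fun u v => iff_refl _).

Lemma aut_mul_root (f g : aut) : (g \o f) root = root.
Proof. by rewrite /= !aut_root. Qed.

Lemma aut_mul_adj (f g : aut) u v :
  adjacent ((g \o f) u) ((g \o f) v) <-> adjacent u v.
Proof. by split=> [/aut_adj/aut_adj//|uv]; do 2!apply/aut_adj. Qed.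

(* As for [{perm T}], the left factor is applied first. *)
Definition aut_mul (f g : aut) : aut :=
  Aut (bij_comp (aut_bij g) (aut_bij f)) (aut_mul_root f g)
    (aut_mul_adj f g).

Lemma aut_inv_ex (f : aut) : exists g : aut, cancel f g /\ cancel g f.
Proof.
have [g fK gK] := aut_bij f.
have gr : g root = root by rewrite -[X in g X](aut_root f) fK.
have ga u v : adjacent (g u) (g v) <-> adjacent u v.
  by rewrite -[X in _ <-> adjacent X _]gK -[X in _ <-> adjacent _ X]gK aut_adj.
by exists (@Aut g (Bijective gK fK) gr ga).
Qed.

Definition aut_inv (f : aut) : aut := sval (cid (aut_inv_ex f)).

Lemma aut_invK (f : aut) : cancel f (aut_inv f) /\ cancel (aut_inv f) f.
Proof. exact: svalP (cid (aut_inv_ex f)). Qed.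

Lemma aut_mulA : associative aut_mul.
Proof. by move=> f g h; exact: aut_eq. Qed.

Lemma aut_mul1g : left_id aut1 aut_mul.
Proof. by move=> f; exact: aut_eq. Qed.

Lemma aut_mulg1 : right_id aut1 aut_mul.
Proof. by move=> f; exact: aut_eq. Qed.

Lemma aut_mulVg : left_inverse aut1 aut_inv aut_mul.
Proof. by move=> f; apply: aut_eq => u; exact: (aut_invK f).2. Qed.

Lemma aut_mulgV : right_inverse aut1 aut_inv aut_mul.
Proof. by move=> f; apply: aut_eq => u; exact: (aut_invK f).1. Qed.

HB.instance Definition _ :=
  isGroup.Build aut aut_mulA aut_mul1g aut_mulg1 aut_mulVg aut_mulgV.

Implicit Types G : set aut.

Definition rst G v : set aut :=
  [set g | G g /\ forall u, ~ subtree v u -> g u = u].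

Definition rst_level G (n : nat) : set aut :=
  generated (\bigcup_(v in level n) rst G v).

Definition spherically_transitive G : Prop :=
  forall n u v, level n u -> level n v -> exists2 g, G g & g u = v.

Definition branch G : Prop :=
  [/\ subgroup G, spherically_transitive G
    & forall n, has_finite_index G (rst_level G n)].

End Tree.

(* Main.v *)
(* Let x be left Engel and let the orbit of a vertex v have length m > 1. If g
   in rst(v) commutes with x^m, the m conjugates of g under the powers of x
   commute, x permutes them cyclically, and [g,_n x] is the image of g under
   (X - 1)^n in Z[X]/(X^m - 1). Its vanishing forces g to be a p-element for
   every prime p dividing m.
   Some power x^s with s > 0 lies in rst(level of v); its component at v
   commutes with x^m, so it has finite order and a power of x is trivial below
   v. Below v there is then a vertex w whose orbit length is maximal, and
   divisible by m; the corresponding power of x centralises rst(w), which is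
   therefore a p-group for every prime p dividing m. By transitivity and
   finite index, G is virtually a p-group. Applied to any other left Engel
   element and any prime q dividing its order, the same argument gives a
   vertex with rst a q-group. Since rigid stabilisers are nontrivial, and
   conjugate at a given level, q = p. *)
Require Import Defs.
From mathcomp Require Import all_boot all_algebra.
From mathcomp Require Import all_classical.
From mathcomp Require Import ring.

Set Implicit Arguments.
Unset Strict Implicit.
Unset Printing Implicit Defensive.

Import GRing.Theory.
Local Open Scope group_scope.

(** * Integer polynomials acting on an element with commuting conjugates *)

Section IntegerPolynomialAction.

Definition expgz (gT : groupType) (g : gT) (z : int) : gT :=
  match z with Posz n => g ^+ n | Negz n => g ^- n.+1 end.

Variable gT : groupType.
Implicit Types (g h x y : gT) (z : int) (P Q R : {poly int}).

Lemma commute_expgz g h z z' :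
  commute g h -> commute (expgz g z) (expgz h z').
Proof.
have H g' h' v : commute g' h' -> commute g' (expgz h' v).
  by move=> gh; case: v => n; [|apply: commuteV]; apply: commuteX.
by move=> gh; apply/H/commute_sym/H/commute_sym.
Qed.

Lemma expgzB g (m n : nat) : expgz g (m%:Z - n%:Z)%R = g ^+ m / g ^+ n.
Proof.
have [le_nm|lt_mn] := leqP n m; first by rewrite subzn //= expgnFr.
have [k ->] : exists k, n = (m + k.+1)%N.
  by exists (n - m).-1; rewrite prednK ?subn_gt0 // subnKC // ltnW.
have -> : (m%:Z - (m + k.+1)%N%:Z = Negz k)%R by rewrite NegzE PoszD; ring.
by rewrite /= addnC expgnDr invgM mulgA mulgV mul1g.
Qed.

Lemma expgzD g z z' : expgz g (z + z')%R = expgz g z * expgz g z'.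
Proof.
(* Writing integers as differences of naturals replaces the case analysis on signs by [expgzB]. *)
have intB v : exists m n : nat, v = (m%:Z - n%:Z)%R.
  by case: v => n; [exists n, 0; rewrite subr0|exists 0, n.+1; rewrite NegzE sub0r].
have [a [b ->]] := intB z; have [c [e ->]] := intB z'.
have -> : (a%:Z - b%:Z + (c%:Z - e%:Z) = (a + c)%N%:Z - (b + e)%N%:Z)%R.
  by rewrite !PoszD; ring.
have cg i j : commute (g ^+ i) (g ^+ j) by exact: commuteX2.
rewrite !expgzB !expgnDr invgM -!mulgA; congr (_ * _); rewrite !mulgA.
apply/esym; rewrite -mulgA; apply: commuteM; last apply: commuteV.
  by apply/commute_sym/commuteV.
by apply/commute_sym/commuteV.
Qed.

(* The image of [g] under [P], the variable acting as conjugation by [x]; this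
   is a module structure over [Z[X]] on the subgroup generated by the conjugates
   of [g] by the powers of [x] when these commute. *)
Definition poly_act g x P : gT :=
  \prod_(0 <= i < size P) expgz (g ^ (x ^+ i)) (P`_i)%R.

Variables g x : gT.
Hypothesis g_comm : forall i j, commute (g ^ (x ^+ i)) (g ^ (x ^+ j)).

Lemma poly_act_widen P n : (size P <= n)%N ->
  poly_act g x P = \prod_(0 <= i < n) expgz (g ^ (x ^+ i)) (P`_i)%R.
Proof.
move=> leP; rewrite (big_cat_nat (n := size P)) //= [X in _ = _ * X]big_nat_cond.
rewrite [X in _ * X]big1 ?mulg1 // => i /andP[/andP[Pi _] _].
by rewrite nth_default.
Qed.

Lemma poly_actD P Q :
  poly_act g x (P + Q)%R = poly_act g x P * poly_act g x Q.
Proof.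
pose n := maxn (size P) (size Q).
rewrite (@poly_act_widen (P + Q)%R n) ?size_polyD //.
rewrite (@poly_act_widen P n) ?leq_maxl // (@poly_act_widen Q n) ?leq_maxr //.
rewrite -prodgM_commute => [|i j _ _]; last exact: commute_expgz.
by apply: eq_bigr => i _; rewrite coefD expgzD.
Qed.

Lemma poly_act0 : poly_act g x 0%R = 1.
Proof. by rewrite /poly_act size_poly0 big_geq. Qed.

Lemma poly_act1 : poly_act g x 1%R = g.
Proof. by rewrite /poly_act size_poly1 big_nat1 coef1 /= conjg1. Qed.

Lemma poly_actN P : poly_act g x (- P)%R = (poly_act g x P)^-1.
Proof. by apply/esym/mulg1_eq; rewrite -poly_actD subrr poly_act0. Qed.

Lemma poly_actMX P : poly_act g x (P * 'X)%R = poly_act g x P ^ x.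
Proof.
have [->|P0] := eqVneq P 0%R; first by rewrite mul0r poly_act0 conj1g.
rewrite /poly_act size_mulX // big_nat_recl //= coefMX eqxx mul1g conjg_prod.
apply: eq_bigr => i _; rewrite coefMX /= expgSr conjgM.
by case: (P`_i)%R => n; rewrite /= ?conjVg conjXg.
Qed.

Lemma poly_actMXn P n : poly_act g x (P * 'X^n)%R = poly_act g x P ^ (x ^+ n).
Proof.
elim: n => [|n IHn]; first by rewrite expr0 mulr1 conjg1.
by rewrite exprSr mulrA poly_actMX IHn -conjgM -expgSr.
Qed.

Lemma poly_act_comm P : poly_act g x (('X - 1) * P)%R = [~ poly_act g x P, x].
Proof.
by rewrite mulrC mulrBr mulr1 addrC poly_actD poly_actN poly_actMX commgEl.
Qed.

Lemma poly_act_iter_commg n : poly_act g x (('X - 1) ^+ n)%R = iter_commg g n x.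
Proof.
elim: n => [|n IHn]; first by rewrite expr0 poly_act1.
by rewrite exprS poly_act_comm IHn.
Qed.

(** The annihilator of [g] is an ideal: multiplying by ['X] conjugates by [x], and multiplying by a
    constant amounts to repeated addition. *)
Lemma poly_act_mul_eq1 P Q : poly_act g x Q = 1 -> poly_act g x (P * Q)%R = 1.
Proof.
move=> Q1; elim/poly_ind: P => [|P c IH]; first by rewrite mul0r poly_act0.
rewrite mulrDl poly_actD mulrAC poly_actMX IH conj1g mul1g.
rewrite -[c]intz mul_polyC scaler_int.
have actMn n : poly_act g x (Q *+ n)%R = 1.
  by elim: n => [|n IHn]; rewrite ?mulr0n ?poly_act0 // mulrS poly_actD Q1 IHn mul1g.
by case: c => n; rewrite ?NegzE ?mulrNz ?poly_actN -pmulrn actMn ?invg1.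
Qed.

Lemma poly_act_natmul n P : poly_act g x (n%:R * P)%R = poly_act g x P ^+ n.
Proof.
rewrite mulr_natl; elim: n => [|n IHn]; first by rewrite mulr0n poly_act0.
by rewrite mulrS poly_actD IHn expgS.
Qed.

End IntegerPolynomialAction.

(* Write [Phi] for [1 + Y + ... + Y^(p-1)]. As [Phi = p] modulo [Y - 1] and
   [Phi * (Y - 1) = Y^p - 1], modulo the latter [p * (Y - 1)] is a multiple
   of [(Y - 1)^2]. *)
Lemma natX_mulB1 (R : comPzRingType) (Y : R) (p k : nat) :
  exists a b, (p%:R ^+ k * (Y - 1) = a * (Y - 1) ^+ k.+1 + b * (Y ^+ p - 1))%R.
Proof.
elim: k => [|k [a [b IHk]]].
  by exists 1%R, 0%R; rewrite expr0 !mul1r mul0r addr0.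
pose Phi := (\sum_(i < p) Y ^+ i)%R.
pose psi := (\sum_(i < p) \sum_(j < i) Y ^+ j)%R.
have PhiE : (p%:R = Phi - (Y - 1) * psi)%R.
  rewrite /psi mulr_sumr /Phi -sumrB.
  rewrite (eq_bigr (fun=> 1%R)) => [|i _]; first by rewrite sumr_const card_ord.
  by rewrite -subrX1 subKr.
exists (- a * psi)%R, (p%:R * b + a * (Y - 1) ^+ k)%R.
rewrite exprSr mulrAC IHk mulrDl [in X in (X + _ = _)%R]PhiE.
by rewrite subrX1 -/Phi !exprS; ring.
Qed.

(* In the module generated by [g], [(X - 1)^n] and [X^m - 1] vanish, hence so
   does [(Y - 1)^n] for [Y = X^(m/p)], which is divisible by [X - 1], and
   then [p^n (Y - 1)] by [natX_mulB1]. *)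
Lemma iter_commg_commg_exp (gT : groupType) (g x : gT) (m p n : nat) :
  (forall i j, commute (g ^ (x ^+ i)) (g ^ (x ^+ j))) ->
  (p %| m)%N -> commute g (x ^+ m) -> iter_commg g n x = 1 ->
  [~ g, x ^+ (m %/ p)] ^+ (p ^ n) = 1.
Proof.
move=> g_comm p_m gxm gn; set q := (m %/ p)%N.
have actX1 i : poly_act g x ('X^i - 1)%R = [~ g, x ^+ i].
  have -> : ('X^i - 1 = - 1 + 1 * 'X^i :> {poly int})%R by rewrite mul1r addrC.
  by rewrite poly_actD // poly_actN // poly_actMXn // poly_act1 commgEl.
rewrite -actX1 -poly_act_natmul // natrX.
have [a [b ->]] := natX_mulB1 ('X^q : {poly int})%R p n.
rewrite poly_actD // -exprM divnK // [X in _ * X]poly_act_mul_eq1 ?mulg1 //; last first.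
  by rewrite actX1; apply/eqP/commgP.
rewrite subrX1; set S := (\sum_(i < q) _)%R.
have -> : (a * (('X - 1) * S) ^+ n.+1 =
           (a * ('X - 1) * S ^+ n.+1) * ('X - 1) ^+ n)%R.
  by rewrite exprMn exprS; ring.
by rewrite poly_act_mul_eq1 // poly_act_iter_commg.
Qed.

(** * Orders, p-elements and powers falling in a subgroup of finite index *)

Section Order.
Variable gT : groupType.
Implicit Type x : gT.

Lemma has_order_dvdn x m n : has_order x m -> x ^+ n = 1 -> (m %| n)%N.
Proof.
move=> [m_gt0 xm m_min] xn; rewrite /dvdn; apply: contraT; rewrite -lt0n => r_gt0.
have := m_min _ r_gt0; rewrite leqNgt ltn_mod m_gt0; apply.
by move: xn; rewrite {1}(divn_eq n m) expgnDr mulnC expgnA xm expg1n mul1g.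
Qed.

Lemma has_order_exists x n : (0 < n)%N -> x ^+ n = 1 -> exists m, has_order x m.
Proof.
move=> n_gt0 xn; pose P i := (0 < i)%N && (x ^+ i == 1).
have exP : exists i, P i by exists n; rewrite /P n_gt0 xn eqxx.
exists (ex_minn exP); case: ex_minnP => m /andP[m_gt0 /eqP xm] m_min.
by split=> // i i_gt0 xi; apply: m_min; rewrite /P i_gt0 xi eqxx.
Qed.

(** Lets later arguments exhibit any exponent [p ^ k] without care for minimality. *)
Lemma p_elementP p x :
  prime p -> p_element p x <-> exists k, x ^+ (p ^ k) = 1.
Proof.
move=> p_pr; split=> [[k [_ xk _]]|[k xk]]; first by exists k.
have [|m om] := has_order_exists _ xk; first by rewrite expn_gt0 prime_gt0.
by have /(dvdn_pfactor _ _ p_pr)[i _ mE] := has_order_dvdn om xk; exists i; rewrite -mE.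
Qed.

Lemma p_element_conj p x y : prime p -> p_element p x -> p_element p (x ^ y).
Proof.
move=> p_pr /(p_elementP _ p_pr)[i xi]; apply/p_elementP => //.
by exists i; rewrite -conjXg xi conj1g.
Qed.

Lemma p_element_inj p q x :
  prime p -> prime q -> p_element p x -> p_element q x -> x != 1 -> p = q.
Proof.
move=> p_pr q_pr /(p_elementP _ p_pr)[i xi] [[|j] oq].
  by case: oq => _; rewrite expn0 expg1 => ->; rewrite eqxx.
have /(dvdn_trans (dvdn_exp (ltn0Sn j) (dvdnn q))) := has_order_dvdn oq xi.
by rewrite Euclid_dvdX // dvdn_prime2 // => /andP[/eqP].
Qed.

(** Pigeonhole on the cosets of the powers of [x]: if those of [x ^+ i] and [x ^+ j] agree, then
    [x ^+ (j - i)] is in [H]. *)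
Lemma finite_index_exp (G H : set gT) x :
  subgroup G -> subgroup H -> has_finite_index G H -> G x ->
  exists2 n, (0 < n)%N & H (x ^+ n).
Proof.
move=> [G1 GM GV] [H1 HM HV] finGH Gx.
have GX n : G (x ^+ n) by elim: n => // n IHn; rewrite expgS; apply: GM.
have [s sE] := (finite_seqP _).1 finGH.
pose C n := [set x ^+ n * h | h in H]%classic.
have Cs n : C n \in s.
  have : [set` s]%classic (C n) by rewrite -sE; exists (x ^+ n).
  by [].
have /uniqPn : ~~ uniq [seq C n | n <- iota 0 (size s).+1].
  apply/negP => us; suff : ((size s).+1 <= size s)%N by rewrite ltnn.
  rewrite -[X in (X <= _)%N](size_iota 0) -(size_map C).
  by apply: uniq_leq_size => // _ /mapP[n _ ->].
move=> /(_ (C 0))[i [j []]]; rewrite size_map size_iota => lt_ij lt_js.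
have lt_is := ltn_trans lt_ij lt_js.
rewrite !(nth_map 0) ?size_iota // !nth_iota // !add0n => Cij.
exists (j - i)%N; first by rewrite subn_gt0.
have : C i (x ^+ j) by rewrite Cij; exists 1 => //; rewrite mulg1.
by move=> [h Hh]; rewrite -{1}(subnKC (ltnW lt_ij)) expgnDr => /mulgI <-.
Qed.

End Order.

(** * Automorphisms, levels and subtrees *)

Section TreeAutomorphisms.
Variable d : nat -> nat.
Implicit Types (u v w : vertex d) (f g x y : aut d) (G : set (aut d)).

Lemma autM f g u : (f * g) u = g (f u). Proof. by []. Qed.

Lemma autK f : cancel f (f^-1)%g. Proof. exact: (aut_invK f).1. Qed.

Lemma autVK f : cancel (f^-1)%g f. Proof. exact: (aut_invK f).2. Qed.

Lemma aut_inj f : injective f. Proof. exact: can_inj (autK f). Qed.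

Lemma is_vertex_rcons s i :
  is_vertex d (rcons s i) = is_vertex d s && (i < d (size s))%N.
Proof.
rewrite /is_vertex size_rcons -addn1 iotaD all_cat /= add0n nth_rcons ltnn eqxx andbT.
congr (_ && _); apply: eq_in_all => j; rewrite mem_iota /= add0n => lt_js.
by rewrite nth_rcons lt_js.
Qed.

Lemma is_vertex_take n s : is_vertex d s -> is_vertex d (take n s).
Proof.
elim/last_ind: s => [//|s i IHs]; rewrite is_vertex_rcons => /andP[s_v lt_i].
rewrite -cats1 take_cat; case: ltnP => _; first exact: IHs.
by case: (n - size s)%N => [|k] /=; rewrite ?cats0 // cats1 is_vertex_rcons s_v.
Qed.

(** The ancestor of [v] at level [n], or [v] itself if its level is at most [n]. *)
Definition vtake n v : vertex d := exist _ (take n (val v)) (is_vertex_take n (valP v)).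

Lemma vtake_oversize n v : (size (val v) <= n)%N -> vtake n v = v.
Proof. by move=> le_vn; apply: val_inj; rewrite /= take_oversize. Qed.

Lemma is_child_vtake v n : size (val v) = n.+1 -> is_child (vtake n v) v.
Proof.
case: v => s s_v /= sn; case/lastP: s => // s i in s_v sn *.
move: sn; rewrite size_rcons => -[<-]; exists i.
by rewrite /= -[in take _ _]cats1 take_size_cat.
Qed.

(** Strong induction on the level. The image of [v] is adjacent to that of its parent; were it
    above, the induction hypothesis for the inverse of [f] would place [v] itself too high. *)
Lemma aut_size f v : size (val (f v)) = size (val v).
Proof.
suff H n : forall f v, size (val v) = n -> size (val (f v)) = n by exact: H.
elim/ltn_ind: n => -[|n] IHn {}f {}v vn.
  have -> : v = Defs.root d by apply: val_inj; exact: size0nil.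
  by rewrite aut_root.
have un : size (val (vtake n v)) = n by rewrite /= size_take vn ltnSn.
have fun_ := IHn n (ltnSn n) f _ un.
have /(aut_adj f) : adjacent (vtake n v) v by left; exact: is_child_vtake.
move=> [] [i E].
  by rewrite E size_rcons fun_.
have fvn : size (val (f v)) = n.-1 by rewrite -fun_ E size_rcons.
have := IHn n.-1 _ (f^-1)%g _ fvn; rewrite autK vn ltnS leq_pred => /(_ isT).
by case: n {IHn un fun_ E fvn vn} => // n /= /eqP; rewrite eqn_leq ltnNge leqnSn.
Qed.

Lemma aut_child f u v : is_child u v -> is_child (f u) (f v).
Proof.
move=> uv; have /(aut_adj f)[//|[j /(congr1 size)]] : adjacent u v by left.
case: uv => i /(congr1 size).
rewrite !size_rcons !aut_size => -> /eqP.
by rewrite eqn_leq (leqNgt _.+2) ltnS leqnSn andbF.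
Qed.

(** Induction on the level of [v], through its parent. With [subtreeE], it makes automorphisms carry
    subtrees to subtrees. *)
Lemma aut_vtake f n v : f (vtake n v) = vtake n (f v).
Proof.
suff H k : size (val v) = k -> f (vtake n v) = vtake n (f v) by exact: H.
elim: k v => [|k IHk] v vk.
  by rewrite !vtake_oversize ?aut_size ?vk.
have [lt_kn|le_nk] := ltnP k n; first by rewrite !vtake_oversize ?aut_size ?vk.
have uv := is_child_vtake vk; set u := vtake k v in uv.
have uk : size (val u) = k by rewrite /= size_take vk ltnSn.
have take_child a b : size (val a) = k -> is_child a b -> vtake n b = vtake n a.
  move=> ak [i bE]; apply: val_inj; rewrite /= bE -cats1 take_cat ak.
  case: ltngtP le_nk => // -> _.
  by rewrite subnn cats0 -{1}ak take_size.
rewrite (take_child u) // IHk // (take_child (f u) (f v)) ?aut_size //.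
exact: aut_child.
Qed.

Lemma subtreeE v u : subtree v u <-> vtake (size (val v)) u = v.
Proof.
rewrite /subtree /= prefixE; split=> [/eqP E|E]; first exact: val_inj.
by apply/eqP; exact: (congr1 val E).
Qed.


Lemma subtree_refl v : subtree v v.
Proof. exact: prefix_refl. Qed.

Lemma subtree_trans u v w : subtree v w -> subtree w u -> subtree v u.
Proof. exact: prefix_trans. Qed.

Lemma aut_subtree f v u : subtree v u -> subtree (f v) (f u).
Proof. by move=> /subtreeE vu; apply/subtreeE; rewrite aut_size -aut_vtake vu. Qed.

Lemma aut_subtreeV f v u : subtree (f v) u -> subtree v ((f^-1)%g u).
Proof. by move=> /(aut_subtree f^-1); rewrite autK. Qed.

Lemma subtree_inj u v w :
  size (val v) = size (val w) -> subtree v u -> subtree w u -> v = w.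
Proof. by move=> vw /subtreeE <- /subtreeE <-; rewrite vw. Qed.

Lemma subtree_anti u v : subtree v u -> (size (val u) <= size (val v))%N -> u = v.
Proof. by move=> /subtreeE E le_uv; rewrite -[RHS]E vtake_oversize. Qed.

Lemma aut_fix_subtree f v u : subtree v u -> f u = u -> f v = v.
Proof. by move=> /subtreeE E fu; rewrite -E aut_vtake fu. Qed.

Lemma autXS f n u : (f ^+ n.+1) u = f ((f ^+ n) u).
Proof. by rewrite expgSr. Qed.

Lemma autX_fix f n u : f u = u -> (f ^+ n) u = u.
Proof. by move=> fu; elim: n => // n IHn; rewrite autXS IHn. Qed.

Definition supported f (S : set (vertex d)) : Prop := forall u, ~ S u -> f u = u.

Lemma supported_stable f S u : supported f S -> S u -> S (f u).
Proof.
move=> fS Su; apply: contrapT => nSfu.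
by have /aut_inj fu := fS _ nSfu; rewrite fu in nSfu.
Qed.

(** Each automorphism maps its own set into itself and fixes the other set pointwise. *)
Lemma commute_supported f g S T :
  supported f S -> supported g T -> (forall u, S u -> ~ T u) -> commute f g.
Proof.
move=> fS gT ST; apply: aut_eq => u /=.
have [Su|nSu] := pselect (S u).
  by rewrite (gT u) ?(gT (f u)) //; apply: ST => //; exact: supported_stable.
rewrite (fS u) // fS // => Sgu; apply: (ST _ Sgu).
have [Tu|nTu] := pselect (T u); first exact: supported_stable.
by move: Sgu; rewrite gT.
Qed.

(** * Rigid stabilisers of vertices and levels *)

Section Subgroup.
Variable G : set (aut d).
Hypothesis subG : subgroup G.

Lemma subgroupX f n : G f -> G (f ^+ n).
Proof.
by have [G1 GM _] := subG; move=> Gf; elim: n => // n IHn; rewrite expgS; apply: GM.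
Qed.

Lemma subgroupJ f g : G f -> G g -> G (f ^ g).
Proof.
have [_ GM GV] := subG; move=> Gf Gg; rewrite conjgE.
by apply: (GM); [apply: GV | apply: GM].
Qed.

Lemma rst1 v : rst G v 1.
Proof. by have [G1 _ _] := subG; split. Qed.

Lemma rstM v f g : rst G v f -> rst G v g -> rst G v (f * g).
Proof.
have [_ GM _] := subG; move=> [Gf fv] [Gg gv]; split; first exact: GM.
by move=> u nu; rewrite autM fv // gv.
Qed.

Lemma rstV v f : rst G v f -> rst G v f^-1.
Proof.
have [_ _ GV] := subG; move=> [Gf fv]; split; first exact: GV.
by move=> u nu; apply: (@aut_inj f); rewrite autVK fv.
Qed.

Lemma rstX v f n : rst G v f -> rst G v (f ^+ n).
Proof.
move=> fv; elim: n => [|n IHn]; first exact: rst1.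
by rewrite expgS; apply: rstM.
Qed.

Lemma rst_stable v f u : rst G v f -> subtree v u -> subtree v (f u).
Proof. by move=> [_ fv]; exact: supported_stable. Qed.

Lemma rst_sub v w : subtree v w -> (rst G w `<=` rst G v)%classic.
Proof.
move=> vw f [Gf fw]; split=> // u nvu; apply: fw => wu; apply: nvu.
exact: subtree_trans wu.
Qed.

Lemma rst_fix v f u : rst G v f -> (size (val u) <= size (val v))%N -> f u = u.
Proof.
move=> fv le_uv; have [vu|] := pselect (subtree v u); last exact: fv.2.
have uv := subtree_anti vu le_uv; rewrite uv.
by apply: subtree_anti; [apply: rst_stable (subtree_refl v) | rewrite aut_size].
Qed.

Lemma rstJ v f g : G g -> rst G v f -> rst G (g v) (f ^ g).
Proof.
move=> Gg [Gf fv]; split=> [|u nu]; first exact: subgroupJ.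
rewrite conjgE !autM fv ?autVK // => vu; apply: nu.
by rewrite -[u](autVK g); exact: aut_subtree.
Qed.

Lemma rst_commute v w f g : size (val v) = size (val w) -> v <> w ->
  rst G v f -> rst G w g -> commute f g.
Proof.
move=> vw nvw [_ fv] [_ gw]; apply: commute_supported fv gw _ => u vu wu.
exact/nvw/(subtree_inj vw vu wu).
Qed.

Lemma rst_level_subgroup n : subgroup (rst_level G n).
Proof.
split=> [A [[A1 _ _] _] //|x y xH yH A|x xH A] AP; have [[_ AM AV] _] := AP.
  by apply: AM; [apply: xH | apply: yH].
by apply: AV; apply: xH.
Qed.

Lemma rst_level_sub n : (rst_level G n `<=` G)%classic.
Proof. by apply: smallest_sub => // g [v _ []]. Qed.

(** Plays the part of the direct product decomposition: [g] is the component of [f] at [w]. The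
    property defines a subgroup containing the generators. *)
Lemma rst_levelP n f : rst_level G n f ->
  (forall u, (size (val u) <= n)%N -> f u = u) /\
  forall w, level n w ->
    exists2 g, rst G w g & forall u, subtree w u -> f u = g u.
Proof.
move: f; apply: smallest_sub => [|f [v vn fv]]; last first.
  split=> [u le_un|w wn]; first by apply: (rst_fix fv); rewrite vn.
  have [<-|nvw] := pselect (v = w); first by exists f.
  exists 1 => [|u wu]; first exact: rst1.
  apply: fv.2 => vu; apply: nvw; apply: (subtree_inj _ vu wu).
  by rewrite vn wn.
split=> [|f g [fn fP] [gn gP]|f [fn fP]].
- by split=> // w _; exists 1 => //; exact: rst1.
- split=> [u un|w wn]; first by rewrite autM fn // gn.
  have [[f' f'w fE] [g' g'w gE]] := (fP w wn, gP w wn).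
  exists (f' * g') => [|u wu]; first exact: rstM.
  by rewrite !autM fE // gE //; exact: rst_stable.
split=> [u un|w wn]; first by apply: (@aut_inj f); rewrite autVK fn.
have [f' f'w fE] := fP w wn; exists f'^-1 => [|u wu]; first exact: rstV.
apply: (@aut_inj f); rewrite autVK fE ?autVK //.
exact/rst_stable/wu/rstV.
Qed.

Lemma rst_exp_eq v f g n u : rst G v g -> (forall u, subtree v u -> f u = g u) ->
  subtree v u -> (f ^+ n) u = (g ^+ n) u.
Proof.
move=> gv fg vu; elim: n => // n IHn; rewrite !autXS IHn fg //.
exact: rst_stable (rstX n gv) vu.
Qed.

End Subgroup.

(** * Orbit lengths of vertices and the Engel condition *)

Definition period x v (m : nat) : Prop :=
  (0 < m)%N /\ forall j, (x ^+ j) v = v <-> (m %| j)%N.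

Lemma period_exists x v n : (0 < n)%N -> (x ^+ n) v = v -> exists m, period x v m.
Proof.
move=> n_gt0 xn; pose P i := (0 < i)%N && `[< (x ^+ i) v = v >].
have exP : exists i, P i by exists n; rewrite /P n_gt0; apply/asboolP.
exists (ex_minn exP); case: ex_minnP => m /andP[m_gt0 /asboolP xm] m_min.
split=> // j; split=> [xj|/dvdnP[k ->]]; last first.
  by rewrite mulnC expgnA autX_fix.
rewrite /dvdn; apply: contraT; rewrite -lt0n => r_gt0.
have /m_min : P (j %% m)%N.
  rewrite /P r_gt0; apply/asboolP; move: xj.
  by rewrite {1}(divn_eq j m) expgnDr autM mulnC expgnA (autX_fix _ xm).
by rewrite leqNgt ltn_mod m_gt0.
Qed.

Lemma period_gt1 x v m : period x v m -> x v <> v -> (1 < m)%N.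
Proof.
move=> [m_gt0 xm] xv; rewrite ltn_neqAle m_gt0 andbT; apply/eqP => m1; apply: xv.
by have := (xm 1%N).2; rewrite expg1 -m1; apply.
Qed.

Lemma period_eq x v m i j :
  period x v m -> (x ^+ i) v = (x ^+ j) v -> i = j %[mod m].
Proof.
move=> [_ xm]; wlog le_ij : i j / (i <= j)%N => [wl E|].
  by case/orP: (leq_total i j) => /wl->.
rewrite -{1}(subnK le_ij) expgnDr autM => /aut_inj/esym/xm m_ij.
by apply/esym/eqP; rewrite eqn_mod_dvd.
Qed.

(** Conjugates of [g] by powers of [x] are equal or live on disjoint subtrees, so they commute and
    [iter_commg_commg_exp] applies. For [q = m %/ p], the conjugate by [x ^+ q] is trivial on the
    subtree of [v], where the commutator is thus the inverse of [g]. *)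
Lemma rst_p_element G x v m p g :
  subgroup G -> left_engel G x -> period x v m -> prime p -> (p %| m)%N ->
  rst G v g -> commute g (x ^+ m) -> p_element p g.
Proof.
move=> subG [Gx x_engel] xm p_pr p_m gv gxm.
have [n gn] := x_engel g gv.1; have m_gt0 := xm.1.
have g_modm i : g ^ (x ^+ i) = g ^ (x ^+ (i %% m)).
  rewrite {1}(divn_eq i m) expgnDr conjgM mulnC expgnA; congr (_ ^ _).
  by apply/conjg_fixP/commgP/commuteX.
have g_comm i j : commute (g ^ (x ^+ i)) (g ^ (x ^+ j)).
  have [/(period_eq xm) E|nE] := pselect ((x ^+ i) v = (x ^+ j) v).
    by rewrite g_modm E -g_modm.
  by apply: (@rst_commute G _ _ _ _ _ nE); rewrite ?aut_size //; apply: rstJ => //;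
    exact: (subgroupX subG _ Gx).
have := iter_commg_commg_exp g_comm p_m gxm gn.
set q := (m %/ p)%N => gq; apply/p_elementP => //; exists n.
have gqv : rst G ((x ^+ q) v) (g ^ (x ^+ q)).
  by apply: rstJ => //; exact: (subgroupX subG _ Gx).
have {}gq : (g ^ (x ^+ q)) ^+ (p ^ n) = g ^+ (p ^ n).
  apply: (@mulgI _ (g ^- (p ^ n))); rewrite mulVg -gq commgEl -expVgn [RHS]expgMn //.
  apply/commute_sym/commuteV.
  by have := g_comm q 0%N; rewrite expg0 conjg1.
apply: aut_eq => u; have [vu|nvu] := pselect (subtree v u); last first.
  exact: (rstX subG _ gv).2.
rewrite -gq; apply: (rstX subG _ gqv).2 => qvu.
(* Impossible, as [0 < q < m]. *)
have /xm.2 : (x ^+ q) v = v by apply: (subtree_inj _ qvu vu); rewrite aut_size.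
move=> /dvdn_leq; rewrite divn_gt0 ?prime_gt0 // dvdn_leq // => /(_ isT).
by rewrite leqNgt ltn_Pdiv // prime_gt1.
Qed.

(* The longest orbits of [x] in the subtree of [w]: if [w'] lies in one, of
   length [M], then [x^M] is trivial below [w'] and so centralises [rst G w']. *)
Lemma rst_p_group G x w m N p :
  subgroup G -> left_engel G x -> (0 < N)%N ->
  (forall u, subtree w u -> (x ^+ N) u = u) -> period x w m ->
  prime p -> (p %| m)%N ->
  exists2 w', subtree w w' & p_group p (rst G w').
Proof.
move=> subG engel_x N_gt0 xN xm p_pr p_m.
pose P M := `[< exists2 u, subtree w u & period x u M >].
have exP : exists M, P M.
  by exists m; apply/asboolP; exists w => //; exact: subtree_refl.
have ubP M : P M -> (M <= N)%N.
  by move=> /asboolP[u wu [_ xM]]; apply: dvdn_leq => //; apply/xM/xN.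
case: (ex_maxnP exP ubP) => M /asboolP[w' ww' xM] M_max.
have mM : (m %| M)%N by apply/xm.2/(aut_fix_subtree ww')/xM.2.
exists w' => // g gw'; apply: (rst_p_element subG engel_x xM p_pr) => //.
  exact: dvdn_trans mM.
apply: (@commute_supported _ _ _ (fun u => ~ subtree w' u) gw'.2) => [u|u w'u] //.
move=> /contrapT w'u; have wu := subtree_trans ww' w'u.
have [M' xM'] := period_exists N_gt0 (xN u wu).
have : P M' by apply/asboolP; exists u.
(* A power of [x] fixing [u] fixes its ancestor [w'], so [M] divides [M']; maximality makes them
   equal. *)
move=> /M_max le_M'M; have : (M %| M')%N.
  by apply/xM.2/(aut_fix_subtree w'u)/xM'.2.
move=> /(dvdn_leq xM'.1) le_MM'; apply/xM'.2.
by have /eqP -> : M == M' by rewrite eqn_leq le_MM'.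
Qed.

(* A power [x^s] lies in [rst_level G n]; its component at [w] commutes with
   [x^m], where [m] is the length of the orbit of [w]. *)
Lemma left_engel_exp_fix G x w : branch G -> left_engel G x -> x w <> w ->
  exists2 N, (0 < N)%N & forall u, subtree w u -> (x ^+ N) u = u.
Proof.
move=> [subG _ finG] engel_x xw; have Gx := engel_x.1; set n := size (val w).
have [s s_gt0 xs] := finite_index_exp subG (rst_level_subgroup G n) (finG n) Gx.
have [xs_fix /(_ w erefl)[y yw xy]] := rst_levelP subG xs.
have [m xm] := period_exists s_gt0 (xs_fix w (leqnn _)).
have m_gt1 := period_gt1 xm xw.
have xmw : (x ^+ m) w = w by apply/xm.2.
have y_comm : commute y (x ^+ m).
  apply/commgP/conjg_fixP/aut_eq => u.
  have yxm : rst G w (y ^ (x ^+ m)).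
    by rewrite -{1}xmw; apply: rstJ => //; exact: (subgroupX subG _ Gx).
  have [wu|nwu] := pselect (subtree w u); last by rewrite yxm.2 // yw.2.
  have wxu : subtree w (((x ^+ m)^-1)%g u) by apply: aut_subtreeV; rewrite xmw.
  (* Below [w], [y] acts as [x ^+ s], which commutes with [x ^+ m]. *)
  rewrite conjgE !autM -(xy _ wxu) -(xy _ wu) -autM.
  by rewrite -expgnDr addnC expgnDr autM autVK.
have p_pr := pdiv_prime m_gt1.
have := rst_p_element subG engel_x xm p_pr (pdiv_dvd m) yw y_comm.
move=> /(p_elementP _ p_pr)[k yk]; exists (s * pdiv m ^ k)%N.
  by rewrite muln_gt0 s_gt0 expn_gt0 prime_gt0.
by move=> u wu; rewrite expgnA (rst_exp_eq subG _ yw) // yk.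
Qed.

Lemma level_finite n : exists s : seq (vertex d), forall v, level n v -> v \in s.
Proof.
elim: n => [|n [s sP]].
  by exists [:: Defs.root d] => v /size0nil v0; rewrite inE; apply/eqP/val_inj.
exists [seq insubd v (rcons (val v) i) | v <- s, i <- iota 0 (d n)] => v vn.
have [i vE] := is_child_vtake vn; set u := vtake n v in vE.
have un : size (val u) = n by rewrite /= size_take vn ltnSn.
have := valP v; rewrite vE is_vertex_rcons un => /andP[_ lt_i].
apply/allpairsP; exists (u, i); split => /=; first exact: sP.
  by rewrite mem_iota.
by apply: val_inj; rewrite val_insubd -vE (valP v).
Qed.

(** The level is finite, so a single power of [p] kills all components; the exponents are added
    along a list of the vertices. *)
Lemma p_group_rst_level G n p : subgroup G -> prime p ->
  (forall v, level n v -> p_group p (rst G v)) -> p_group p (rst_level G n).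
Proof.
move=> subG p_pr pG f fn; have [f_fix fP] := rst_levelP subG fn.
have [s sP] := level_finite n; apply/p_elementP => //.
suff [k fk] : exists k, forall v, v \in s -> level n v ->
    forall u, subtree v u -> (f ^+ (p ^ k)) u = u.
  exists k; apply: aut_eq => u.
  have [le_un|lt_nu] := leqP (size (val u)) n.
    by apply: autX_fix; exact: f_fix.
  have vn : level n (vtake n u) by rewrite /level /= size_take lt_nu.
  by apply: (fk _ (sP _ vn) vn); apply/subtreeE; rewrite vn.
elim: s {sP} => [|v s [k fk]]; first by exists 0%N.
have [vn|nvn] := pselect (level n v); last first.
  by exists k => w; rewrite inE => /orP[/eqP->//|]; exact: fk.
have [g gv fg] := fP v vn.
have /(p_elementP _ p_pr)[i gi] := pG v vn g gv.
exists (k + i)%N => w; rewrite inE expnD => /orP[/eqP-> _ u vu|ws wn u wu].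
  by rewrite mulnC expgnA autX_fix // (rst_exp_eq subG _ gv) // gi.
by rewrite expgnA autX_fix // (fk w).
Qed.

(** * Nontrivial rigid stabilisers and uniqueness of the prime *)

Section Branching.
Hypothesis hd : forall n, (1 < d n)%N.

Lemma is_vertex_le1 s : all (fun i => i <= 1)%N s -> is_vertex d s.
Proof.
move=> /allP s1; apply/allP => i; rewrite mem_iota /= add0n => lt_is.
exact: leq_ltn_trans (s1 _ (mem_nth 0%N lt_is)) (hd i).
Qed.

Lemma subtree_level_exists v n : (size (val v) <= n)%N ->
  exists2 u, subtree v u & level n u.
Proof.
move=> /subnKC; move: (n - _)%N => k; elim: k n => [|k IHk] n <-.
  by exists v; rewrite ?addn0 //; exact: subtree_refl.
have [u vu un] := IHk _ erefl.
have u0 : is_vertex d (rcons (val u) 0%N).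
  by rewrite is_vertex_rcons (valP u) (ltn_trans _ (hd _)).
exists (exist (is_vertex d) _ u0); last by rewrite /level /= size_rcons un addnS.
by apply: prefix_trans vu _; rewrite /= prefix_rcons.
Qed.

Lemma spherically_transitive_infinite G :
  spherically_transitive G -> ~ finite_set G.
Proof.
move=> transG /finite_seqP[s sG]; have [N NE] : exists N, N = (size s).+1 by eexists.
(* The words of length [N] with a single 1 are [N] vertices in the orbit of the zero word, more than
   [G] has elements. *)
pose t i := set_nth 0%N (nseq N 0%N) i 1%N.
have t_v i : is_vertex d (t i).
  apply: is_vertex_le1; apply/allP => j /(nthP 0%N)[k _ <-].
  by rewrite nth_set_nth /= nth_nseq; do 2?case: ifP.
have nseq_v : is_vertex d (nseq N 0%N).
  by apply: is_vertex_le1; apply/allP => j /nseqP[->].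
pose o : vertex d := exist (is_vertex d) _ nseq_v.
pose r i : vertex d := exist (is_vertex d) _ (t_v i).
have r_inj : injective r.
  move=> i j /(congr1 (fun v => nth 0%N (val v) i)) /=.
  by rewrite !nth_set_nth /= eqxx nth_nseq; case: eqP => // _; case: ifP.
have : (N <= size [seq (g : aut d) o | g <- s])%N.
  rewrite -{1}(size_iota 0 N) -(size_map r); apply: uniq_leq_size.
    by rewrite map_inj_uniq ?iota_uniq.
  move=> w /mapP[i]; rewrite mem_iota /= add0n => lt_iN ->.
  have [||g Gg <-] := transG N o (r i).
  - by rewrite /level /= size_nseq.
  - by rewrite /level /= size_set_nth size_nseq; apply/maxn_idPr.
  by apply: map_f; move: Gg; rewrite sG.
by rewrite size_map NE ltnn.
Qed.

(** Otherwise, by conjugation, the rigid stabiliser of the whole level is trivial; having finite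
    index, it makes [G] finite. *)
Lemma rst_neq1 G v : branch G -> exists2 g, rst G v g & g <> 1.
Proof.
move=> [subG transG finG]; apply: contrapT => triv.
have rst1 g : rst G v g -> g = 1.
  by move=> gv; apply: contrapT => g1; apply: triv; exists g.
apply: (spherically_transitive_infinite transG).
have rst_level1 g : rst_level G (size (val v)) g -> g = 1.
  move: g; apply: smallest_sub => [|g [w wn gw]].
    by split=> [//|_ _ -> ->|_ ->]; rewrite ?mulg1 ?invg1.
  have [a Ga aw] := transG _ w v wn erefl.
  apply/eqP; rewrite -(conjg_eq1 _ a); apply/eqP/rst1.
  by rewrite -aw; exact: rstJ.
(* The cosets are singletons, and [xget] recovers the element of each. *)
apply: sub_finite_set (finite_image (xget 1) (finG (size (val v)))) => g Gg.
exists [set g * h | h in rst_level G (size (val v))]%classic; first by exists g.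
have /(xgetI 1)[h /rst_level1 -> <-] : 
    [set g * h | h in rst_level G (size (val v))]%classic g.
  by exists 1; [case: (rst_level_subgroup G (size (val v))) | rewrite mulg1].
by rewrite mulg1.
Qed.

(** Below [v] and [w], choose vertices of a common level: their rigid stabilisers are conjugate and
    nontrivial, so some nontrivial element is both a p-element and a q-element. *)
Lemma prime_unique G v w p q : branch G -> prime p -> prime q ->
  p_group p (rst G v) -> p_group q (rst G w) -> p = q.
Proof.
move=> brG p_pr q_pr pv qw; have [subG transG _] := brG.
have [v' vv' v'n] := subtree_level_exists (leq_addr (size (val w)) (size (val v))).
have [w' ww' w'n] := subtree_level_exists (leq_addl (size (val v)) (size (val w))).
have [g gv' /eqP g1] := rst_neq1 v' brG; have [a Ga av'] := transG _ _ _ v'n w'n.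
apply: (@p_element_inj _ _ _ (g ^ a)) => //; last by rewrite conjg_eq1.
  exact/(p_element_conj _ p_pr)/pv/(rst_sub vv').
by apply: qw; apply: (rst_sub ww'); rewrite -av'; exact: rstJ.
Qed.

End Branching.

End TreeAutomorphisms.

(** * From one nontrivial left Engel element to the whole group *)

Theorem theoremB (d : nat -> nat) (hd : forall n : nat, (1 < d n)%N)
    (G : set (aut d)) (hG : branch G) :
  left_engel G <> [set 1%g]%classic ->
  periodic G /\
  exists p : nat, [/\ prime p,
    forall x : aut d, left_engel G x -> p_element p x
    & virtually_p_group p G].
Proof.
move=> LG1; have [subG transG finG] := hG.
have [x engel_x x1] : exists2 x, left_engel G x & x <> 1.
  apply: contrapT => noL; apply: LG1; apply/seteqP; split=> [x Lx|x ->].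
    by apply: contrapT => x1; apply: noL; exists x.
  by split=> [|g _]; [case: subG | exists 1%N; rewrite /iter_commg /= commg1].
have [w xw] : exists w, x w <> w.
  apply: contrapT => x_id; apply: x1; apply: aut_eq => u.
  by apply: contrapT => xu; apply: x_id; exists u.
have [N N_gt0 xN] := left_engel_exp_fix hG engel_x xw.
have [m xm] := period_exists N_gt0 (xN w (subtree_refl w)).
have m_gt1 := period_gt1 xm xw.
have p_pr := pdiv_prime m_gt1; set p := pdiv m in p_pr.
have [w1 _ pw1] := rst_p_group subG engel_x N_gt0 xN xm p_pr (pdiv_dvd m).
(* By transitivity, all rigid stabilisers at level [n] are conjugate to that of [w1]. *)
set n := size (val w1); have p_rst : p_group p (rst_level G n).
  apply: p_group_rst_level => // v vn g gv.
  have [a Ga av] := transG n v w1 vn erefl.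
  rewrite -(conjgK a g); apply: p_element_conj => //.
  by apply: pw1; rewrite -av; exact: rstJ.
have periodicG : periodic G.
  move=> y Gy.
  have [s s_gt0 ys] := finite_index_exp subG (rst_level_subgroup G n) (finG n) Gy.
  have /(p_elementP _ p_pr)[k yk] := p_rst _ ys.
  by apply: (@has_order_exists _ _ (s * p ^ k)%N);
    rewrite ?expgnA // muln_gt0 s_gt0 expn_gt0 prime_gt0.
split=> //; exists p; split=> // [y engel_y|]; last first.
  exists (rst_level G n); split=> //.
    exact: rst_level_subgroup.
  exact: rst_level_sub.
have [r oy] := periodicG y engel_y.1; have [r_gt0 yr r_min] := oy.
(* It remains to see that each prime [q] dividing the order [r] of [y] is [p]. *)
suff /p_natP[k rE] : p.-nat r by exists k; rewrite -rE.
apply/pnatP => // q q_pr q_r; rewrite inE; apply/eqP/esym.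
have yrq : y ^+ (r %/ q) <> 1.
  move=> /(r_min _ _); rewrite divn_gt0 ?prime_gt0 // dvdn_leq // => /(_ isT).
  by rewrite leqNgt ltn_Pdiv // prime_gt1.
have [v yv] : exists v, (y ^+ (r %/ q)) v <> v.
  apply: contrapT => y_id; apply: yrq; apply: aut_eq => u.
  by apply: contrapT => yu; apply: y_id; exists u.
have y_fix u : (y ^+ r) u = u by rewrite yr.
have [l yl] := period_exists r_gt0 (y_fix v).
(* The orbit length [l] divides [r] but not [r %/ q], since [y ^+ (r %/ q)] moves [v]. *)
have q_l : (q %| l)%N.
  have /yl.2/dvdnP[c rE] := y_fix v; apply: contraT => q_l; exfalso.
  have /dvdnP[c' cE] : (q %| c)%N.
    by move: q_r; rewrite rE Euclid_dvdM // (negbTE q_l) orbF.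
  apply: yv; apply/yl.2.
  by rewrite rE cE mulnAC mulnK ?prime_gt0 // dvdn_mull.
have [v1 _ qv1] := rst_p_group subG engel_y r_gt0 (fun u _ => y_fix u) yl q_pr q_l.
exact: (prime_unique hd hG p_pr q_pr pw1 qv1).
Qed.
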